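(* Let $(L,\cdot)$ be a loop and let $A(L)$ be a group of automorphisms of $(L,\cdot)$. The $A(L)$-holomorph $(H,\circ)$ of $(L,\cdot)$ is an Osborn loop if and only if all of the following hold: (i) $(L,\cdot)$ is an Osborn loop; (ii) $x\alpha\cdot x^{\rho}\in N(L,\cdot)$ and $x^{\lambda}\cdot x\phi\in N(L,\cdot)$; (iii) $(x\alpha\cdot x^{\rho})\cdot x=x\alpha$; (iv) $x\cdot(x^{\lambda}\cdot x\phi^{-1})=x\phi^{-1}$; where (ii)--(iv) are required for every $x\in L$ and all $\alpha,\phi\in A(L)$.
   Context: Maps are written on the right ($x\alpha$ is the image of $x$ under $\alpha$) and composed from left to right. A loop $(L,\cdot)$ is a set with a binary operation having a two-sided identity $e$ such that $a\cdot x=b$ and $y\cdot a=b$ have unique solutions $x,y$ for all $a,b$. For $x\in L$, $x^{\lambda}$ and $x^{\rho}$ are defined by $x^{\lambda}\cdot x=e$ and $x\cdot x^{\rho}=e$; $x\backslash y$ is the unique $z$ with $x\cdot z=y$. A loop is an Osborn loop if it satisfies any one of the identities $x((yz)x)=(x^{\lambda}\backslash y)(zx)$; $x((yz)x)=\big(x((yx^{\lambda})x)\big)(zx)$; $x((yz)x)=\big(x((yx)x^{\rho})\big)(zx)$. For a group $A(L)$ of automorphisms of $(L,\cdot)$ (a subgroup of the full automorphism group of $L$), the $A(L)$-holomorph of $(L,\cdot)$ is the loop $(H,\circ)$ with $H=A(L)\times L$ and $(\alpha,x)\circ(\beta,y)=(\alpha\beta,\,x\beta\cdot y)$. The nucleus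 is $N(L,\cdot)=N_\rho\cap N_\lambda\cap N_\mu$, where $N_\rho=\{x: (zy)x=z(yx)\ \forall y,z\}$, $N_\lambda=\{x: x(yz)=(xy)z\ \forall y,z\}$, $N_\mu=\{x:(zx)y=z(xy)\ \forall y,z\}$. *)

(* Defs.v *)
From HB Require Import structures.
From mathcomp Require Import all_boot.
From Stdlib Require Import FunctionalExtensionality ProofIrrelevance.

Set Implicit Arguments.
Unset Strict Implicit.
Unset Printing Implicit Defensive.

Local Open Scope group_scope.

(* The divisions are operations of the structure: ldivP (resp. rdivP) says that
   a * x = b (resp. y * a = b) has a unique solution, and names it.  The base
   structure BaseUMagma provides *, 1 and their notations, with no axiom and no
   choice or decidable equality on the carrier.                               *)
HB.mixin Record BaseUMagma_isLoop G of BaseUMagma G := {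
  ldiv : G -> G -> G;
  rdiv : G -> G -> G;
  loop_mul1g : left_id (1 : G) (@mul G);
  loop_mulg1 : right_id (1 : G) (@mul G);
  ldivP : forall a b x : G, a * x = b <-> x = ldiv a b;
  rdivP : forall b a y : G, y * a = b <-> y = rdiv b a
}.

#[short(type="loopType")]
HB.structure Definition Loop := {G of BaseUMagma_isLoop G & BaseUMagma G}.

Bind Scope group_scope with Loop.sort.

Section LoopTheory.
Variable L : loopType.

(* lam x * x = 1 and x * rho x = 1 *)
Definition lam (x : L) : L := rdiv 1 x.
Definition rho (x : L) : L := ldiv x 1.

Definition osborn_id1 : Prop :=
  forall x y z : L, x * ((y * z) * x) = ldiv (lam x) y * (z * x).
Definition osborn_id2 : Prop :=
  forall x y z : L,
    x * ((y * z) * x) = (x * ((y * lam x) * x)) * (z * x).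
Definition osborn_id3 : Prop :=
  forall x y z : L,
    x * ((y * z) * x) = (x * ((y * x) * rho x)) * (z * x).

Definition osborn : Prop := [\/ osborn_id1, osborn_id2 | osborn_id3].

Definition in_rnucleus (x : L) : Prop :=
  forall y z : L, (z * y) * x = z * (y * x).
Definition in_lnucleus (x : L) : Prop :=
  forall y z : L, x * (y * z) = (x * y) * z.
Definition in_mnucleus (x : L) : Prop :=
  forall y z : L, (z * x) * y = z * (x * y).
Definition in_nucleus (x : L) : Prop :=
  [/\ in_rnucleus x, in_lnucleus x & in_mnucleus x].

End LoopTheory.

Arguments osborn : clear implicits.
Arguments osborn_id1 : clear implicits.
Arguments osborn_id2 : clear implicits.
Arguments osborn_id3 : clear implicits.

Record automorphism (L : loopType) := Automorphism {
  aut_fun :> L -> L;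
  aut_inv : L -> L;
  aut_funK : cancel aut_fun aut_inv;
  aut_invK : cancel aut_inv aut_fun;
  aut_funM : {morph aut_fun : x y / x * y}
}.

Section AutomorphismGroup.
Variable L : loopType.
Implicit Types alpha beta : automorphism L.

Lemma aut_eq alpha beta : alpha =1 beta -> alpha = beta.
Proof.
case: alpha beta => f f' fK f'K fM [g g' gK g'K gM] /= /functional_extensionality.
move=> fg; subst g.
have E : f' = g'.
  by apply: functional_extensionality => x; rewrite -{1}(g'K x) fK.
subst g'; congr Automorphism; exact: proof_irrelevance.
Qed.

Definition aut_one := @Automorphism L id id (fun _ => erefl) (fun _ => erefl)
  (fun _ _ => erefl).

Lemma aut_invM alpha : {morph aut_inv alpha : x y / x * y}.
Proof.
by move=> x y; rewrite -{1}(aut_invK alpha x) -{1}(aut_invK alpha y)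
  -aut_funM aut_funK.
Qed.

Definition aut_inverse alpha :=
  Automorphism (aut_invK alpha) (aut_funK alpha) (aut_invM alpha).

(* Maps act on the right: the product alpha beta is alpha followed by beta. *)
Lemma aut_mulM alpha beta : {morph beta \o alpha : x y / x * y}.
Proof. by move=> x y /=; rewrite !aut_funM. Qed.

Definition aut_mul alpha beta :=
  Automorphism (can_comp (aut_funK beta) (aut_funK alpha))
    (can_comp (aut_invK alpha) (aut_invK beta)) (aut_mulM alpha beta).

HB.instance Definition _ := hasMul.Build (automorphism L) aut_mul.
HB.instance Definition _ := hasOne.Build (automorphism L) aut_one.
HB.instance Definition _ := hasInv.Build (automorphism L) aut_inverse.

Lemma aut_mulE alpha beta x : (alpha * beta) x = beta (alpha x).
Proof. by []. Qed.

Lemma aut_mulA : associative (@mul (automorphism L)).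
Proof. by move=> a b c; apply: aut_eq. Qed.

Lemma aut_mul1g : left_id 1 (@mul (automorphism L)).
Proof. by move=> a; apply: aut_eq. Qed.

Lemma aut_mulg1 : right_id 1 (@mul (automorphism L)).
Proof. by move=> a; apply: aut_eq. Qed.

Lemma aut_mulVg alpha : alpha^-1 * alpha = 1.
Proof. by apply: aut_eq => x; apply: aut_invK. Qed.

Lemma aut_mulgV alpha : alpha * alpha^-1 = 1.
Proof. by apply: aut_eq => x; apply: aut_funK. Qed.

End AutomorphismGroup.

Record aut_group (L : loopType) := AutGroup {
  in_aut :> automorphism L -> Prop;
  in_aut1 : in_aut 1;
  in_autM : forall alpha beta,
    in_aut alpha -> in_aut beta -> in_aut (alpha * beta);
  in_autV : forall alpha, in_aut alpha -> in_aut alpha^-1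
}.

Definition holomorph (L : loopType) (A : aut_group L) : Type :=
  ({alpha : automorphism L | A alpha} * L)%type.

Section Holomorph.
Variables (L : loopType) (A : aut_group L).
Implicit Types u v w : holomorph A.

Let ga : Type := {alpha : automorphism L | A alpha}.
Let ga1 : ga := exist _ 1 (in_aut1 A).
Let gaM (a b : ga) : ga :=
  exist _ (sval a * sval b) (in_autM (svalP a) (svalP b)).
Let gaV (a : ga) : ga := exist _ (sval a)^-1 (in_autV (svalP a)).

Definition hol_one : holomorph A := (ga1, 1).
Definition hol_mul u v : holomorph A :=
  (gaM u.1 v.1, sval v.1 u.2 * v.2).
Definition hol_ldiv u v : holomorph A :=
  let b := gaM (gaV u.1) v.1 in (b, ldiv (sval b u.2) v.2).
Definition hol_rdiv v u : holomorph A :=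
  (gaM v.1 (gaV u.1), aut_inv (sval u.1) (rdiv v.2 u.2)).

HB.instance Definition _ := hasMul.Build (holomorph A) hol_mul.
HB.instance Definition _ := hasOne.Build (holomorph A) hol_one.

Let ga_eq (a b : ga) : sval a = sval b -> a = b.
Proof.
case: a b => a Aa [b Ab] /= E; subst b; congr exist; exact: proof_irrelevance.
Qed.

Lemma hol_mul1g : left_id (1 : holomorph A) (@mul (holomorph A)).
Proof.
move=> [a x]; congr pair; first exact/ga_eq/aut_mul1g.
rewrite /=; have -> : sval a (1 : L) = 1; last exact: loop_mul1g.
have /ldivP -> : sval a 1 * sval a 1 = sval a 1.
  by rewrite -aut_funM loop_mul1g.
by apply/esym/ldivP; rewrite loop_mulg1.
Qed.

Lemma hol_mulg1 : right_id (1 : holomorph A) (@mul (holomorph A)).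
Proof.
by move=> [a x]; congr pair; [exact/ga_eq/aut_mulg1 | exact: loop_mulg1].
Qed.

Lemma hol_ldivP u w v : u * v = w <-> v = hol_ldiv u w.
Proof.
case: u v w => [a x] [b y] [c z]; split.
  case=> <- /ldivP ->; congr pair; last by rewrite /= aut_invK.
  by apply: ga_eq; rewrite /= aut_mulA aut_mulVg aut_mul1g.
case=> -> ->; congr pair; last by apply/ldivP.
by apply: ga_eq; rewrite /= aut_mulA aut_mulgV aut_mul1g.
Qed.

Lemma hol_rdivP w u v : v * u = w <-> v = hol_rdiv w u.
Proof.
case: u v w => [a x] [b y] [c z]; split.
  case=> <- /rdivP E; rewrite /hol_rdiv /=; congr pair.
    by apply: ga_eq; rewrite /= -aut_mulA aut_mulgV aut_mulg1.
  by rewrite -E aut_funK.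
case=> -> ->; congr pair; last by apply/rdivP; rewrite aut_invK.
by apply: ga_eq; rewrite /= -aut_mulA aut_mulVg aut_mulg1.
Qed.

HB.instance Definition _ :=
  BaseUMagma_isLoop.Build (holomorph A) hol_mul1g hol_mulg1 hol_ldivP hol_rdivP.

Lemma hol_mulE u v :
  u * v = (gaM u.1 v.1, sval v.1 u.2 * v.2) :> holomorph A.
Proof. by []. Qed.

End Holomorph.

(* Main.v *)
Require Import Defs.
From mathcomp Require Import all_boot.
From Stdlib Require Import ProofIrrelevance.

Local Open Scope group_scope.

(** Each of the three Osborn identities implies that [(T, R_x, P_x)], with
[P_x y = x(yx)], is an autotopism, where [T] is the inverse of left
multiplication by [lam x].  The nuclei of an Osborn loop are handled by
conjugating nuclear autotopisms with this one.  In the holomorph, the Osborn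
identity becomes an autotopism [(T', R_x, R_x L_(phi x))] of [L] with the same
middle component; dividing it by the previous one leaves
[L_x^-1 L_(phi x)], which must be left multiplication by the left nuclear
element [n = phi x * rho x], so that [phi x = n x].  Conversely, [phi x = n x]
with [n] nuclear gives [(y * lam (phi x)) * phi x = (y * lam x) * x], which reduces
the Osborn identity of the holomorph to that of [L]. *)

Section Loops.
Variable L : loopType.
Implicit Types x y z u v w n m : L.

Lemma mul_ldiv x y : x * ldiv x y = y.
Proof. exact/ldivP. Qed.

Lemma ldiv_mul x y : ldiv x (x * y) = y.
Proof. by apply/esym/ldivP. Qed.

Lemma rdiv_mul x y : rdiv y x * x = y.
Proof. exact/rdivP. Qed.

Lemma loop_mulgI x y z : x * y = x * z -> y = z.
Proof. by move=> E; rewrite -(ldiv_mul x y) E ldiv_mul. Qed.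

Lemma loop_mulIg x y z : y * x = z * x -> y = z.
Proof. by move/rdivP=> ->; apply/esym/rdivP. Qed.

Lemma mul_lam x : lam x * x = 1.
Proof. exact: rdiv_mul. Qed.

Lemma mul_rho x : x * rho x = 1.
Proof. exact: mul_ldiv. Qed.

Lemma osborn_id1_lam x y : osborn_id1 L ->
  x * ((y * lam x) * x) = ldiv (lam x) y.
Proof. by move=> H; rewrite H mul_lam loop_mulg1. Qed.

Lemma osborn_id1_id2 : osborn_id1 L -> osborn_id2 L.
Proof. by move=> H x y z; rewrite osborn_id1_lam. Qed.

(** Setting [z = lam x] identifies the left factors of the two right-hand sides. *)
Lemma osborn_id3_id2 : osborn_id3 L -> osborn_id2 L.
Proof.
move=> H x y z; rewrite (H x y (lam x)) mul_lam loop_mulg1; exact: H.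
Qed.

(** With [T y = x * ((y * lam x) * x)] and [T (lam x) = 1], the identity at [lam x] and [T y] gives
    [x * ((lam x * T y) * x) = T y * x = x * (y * x)]; cancelling [x] on both sides leaves
    [lam x * T y = y]. *)
Lemma osborn_id2_id1 : osborn_id2 L -> osborn_id1 L.
Proof.
move=> H x y z; rewrite H; congr (_ * _).
have Tlam : x * ((lam x * lam x) * x) = 1.
  by apply: (@loop_mulIg x); have := H x (lam x) 1;
     rewrite loop_mulg1 mul_lam loop_mulg1 loop_mul1g => <-.
apply/(ldivP (lam x))/(@loop_mulIg x)/(@loop_mulgI x).
rewrite (H x (lam x)) Tlam loop_mul1g.
by have := H x y 1; rewrite !loop_mulg1 loop_mul1g.
Qed.

Lemma osborn_id2P : osborn L <-> osborn_id2 L.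
Proof.
split=> [[/osborn_id1_id2|//|/osborn_id3_id2] //|H]; exact: Or32.
Qed.

Section Nucleus.
Hypothesis osbornL : osborn_id1 L.

Lemma osborn_mul x u z : x * (((lam x * u) * z) * x) = u * (z * x).
Proof. by rewrite osbornL ldiv_mul. Qed.

(* Conjugating the autotopism [(L_n, 1, L_n)] by [(T, R_x, P_x)] gives
   [(L_m, 1, L_m)]. *)
Lemma lnucleus_conj x n : in_lnucleus n -> exists m, [/\ in_lnucleus m,
  x * n = m * x & forall y, x * ((n * y) * x) = m * (x * (y * x))].
Proof.
move=> Nn; pose P y := x * (y * x).
(* Left multiplication by [n] conjugated by [P]: [rdiv (ldiv x p) x] is the preimage of [p] under
   [P]. *)
pose F p := P (n * rdiv (ldiv x p) x).
have FP y : F (P y) = P (n * y).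
  by rewrite /F; congr (P (n * _)); apply/esym/rdivP; rewrite ldiv_mul.
have FM u w : F (u * w) = ldiv (lam x) (n * (lam x * u)) * w.
  rewrite -{1 2}(rdiv_mul x w) -osborn_mul -/(P _) FP /P Nn.
  exact: osbornL.
have F1 u : F u = ldiv (lam x) (n * (lam x * u)).
  by rewrite -{1}(loop_mulg1 u) FM loop_mulg1.
have Fl w : F w = F 1 * w by rewrite -{1}(loop_mul1g w) FM -F1.
exists (F 1); split.
- by move=> y z; rewrite -Fl -(Fl y) FM -F1.
- rewrite -Fl F1 mul_lam loop_mulg1.
  by rewrite -osborn_id1_lam // -Nn mul_lam loop_mulg1.
- by move=> y; rewrite -Fl FP.
Qed.

(** With [m] the conjugate of [n], [x * (n * w) = m * (x * w) = (m * x) * w = (x * n) * w]. *)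
Lemma lnucleus_mnucleus n : in_lnucleus n -> in_mnucleus n.
Proof.
move=> Nn w x; have [m [Nm xn xny]] := lnucleus_conj x n Nn.
by rewrite -(rdiv_mul x w) (Nn _ x) xny Nm xn.
Qed.

(* [T] commutes with right multiplication by [n]. *)
Lemma lnucleus_rnucleus n : in_lnucleus n -> in_rnucleus n.
Proof.
move=> Nn u z; have Mn := lnucleus_mnucleus n Nn.
pose x := rho z; have -> : z = lam x by apply/rdivP; rewrite mul_rho.
apply/esym/(ldivP (lam x))/(@loop_mulIg x).
have := osbornL x (lam x * u * n) 1; rewrite loop_mulg1 loop_mul1g => <-.
by rewrite osborn_mul Mn.
Qed.

Lemma lnucleus_nucleus n : in_lnucleus n -> in_nucleus n.
Proof.
by move=> Nn; split; [exact: lnucleus_rnucleus| |exact: lnucleus_mnucleus].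
Qed.

(** The element equals the left nuclear [m] with [lam x * n = m * lam x]. *)
Lemma lam_mul_lnucleus x n : in_lnucleus n -> in_lnucleus (lam x * (n * x)).
Proof.
move=> Nn; have [m [Nm E _]] := lnucleus_conj (lam x) n Nn.
by rewrite -(lnucleus_mnucleus n Nn) E -Nm mul_lam loop_mulg1.
Qed.

Lemma mul_lam_lnucleus x n : in_lnucleus n -> x * (lam x * (n * x)) = n * x.
Proof.
move=> Nn; rewrite -(lnucleus_mnucleus n Nn) //.
by have := osborn_mul x n 1; rewrite loop_mulg1 loop_mul1g.
Qed.

Lemma lnucleus_quotient x v :
    (forall y z, v * ((y * z) * x) = (v * ((y * lam x) * x)) * (z * x)) ->
  in_lnucleus (v * rho x) /\ (v * rho x) * x = v.
Proof.
move=> H.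
have E u w : v * ldiv x (u * w) = (v * ldiv x u) * w.
  (* These arguments make [(y * z) * x] equal to [ldiv x (u * w)] and [z * x] equal to [w]. *)
  have := H (lam x * u) (rdiv w x); rewrite rdiv_mul.
  have -> : ((lam x * u) * rdiv w x) * x = ldiv x (u * w).
    by apply/(ldivP x); rewrite osborn_mul rdiv_mul.
  by have -> : ((lam x * u) * lam x) * x = ldiv x u
    by apply/(ldivP x); rewrite osborn_mul mul_lam loop_mulg1.
have E1 w : v * ldiv x w = (v * rho x) * w by rewrite -E loop_mul1g.
split=> [u w|]; first by rewrite -!E1 E.
by rewrite -E1 -{2}(loop_mulg1 x) ldiv_mul loop_mulg1.
Qed.

End Nucleus.

Lemma mul_lam_nucleus n x y : in_nucleus n ->
  (y * lam (n * x)) * (n * x) = (y * lam x) * x.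
Proof.
(* Nuclearity brings [n] next to [lam (n * x)], and [lam (n * x) * n = lam x]. *)
case=> Rn _ Mn; rewrite -Mn Rn; congr ((y * _) * x).
by apply/(rdivP 1 x); rewrite Mn mul_lam.
Qed.

Lemma aut_fun1 (alpha : automorphism L) : alpha 1 = 1.
Proof.
by apply: (@loop_mulgI (alpha 1)); rewrite -aut_funM !loop_mulg1.
Qed.

Lemma aut_fun_lam (alpha : automorphism L) x : alpha (lam x) = lam (alpha x).
Proof. by apply/rdivP; rewrite -aut_funM mul_lam aut_fun1. Qed.

End Loops.

Section HolomorphOsborn.
Variables (L : loopType) (A : aut_group L).

Lemma holomorph_eq (u v : holomorph A) :
  sval u.1 =1 sval v.1 -> u.2 = v.2 -> u = v.
Proof.
case: u v => [[a Aa] x] [[b Ab] y] /= /aut_eq E ->; subst b.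
by congr (exist _ _ _, _); apply: proof_irrelevance.
Qed.

Lemma holomorph_osborn_id2P : osborn_id2 (holomorph A) <->
  forall (phi delta : automorphism L) (x y z : L), A phi -> A delta ->
    phi x * ((y * z) * x)
    = (phi x * ((y * lam (delta x)) * delta x)) * (z * x).
Proof.
split=> H.
  move=> phi delta x y z Aphi Adelta.
  have Ab := in_autM Aphi (in_autV Adelta).
  (* For automorphism parts [a], [b], [c] of [X], [Y], [Z], the second component involves
     [phi = b * c * a] and [delta = c * a]; here [a = 1]. *)
  pose X : holomorph A := (exist _ 1 (in_aut1 A), x).
  pose Y : holomorph A := (exist _ _ Ab, aut_inv delta y).
  pose Z : holomorph A := (exist _ _ Adelta, z).
  have /(f_equal snd) /= := H X Y Z.
  by rewrite !aut_funM !aut_invK -/(lam x) aut_fun_lam.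
move=> [[a Aa] x] [[b Ab] y] [[c Ac] z]; apply: holomorph_eq => [t|] /=.
  by rewrite aut_invK.
rewrite !aut_funM !aut_invK -/(lam x) !aut_fun_lam.
exact: H (in_autM Ab (in_autM Ac Aa)) (in_autM Ac Aa).
Qed.

End HolomorphOsborn.

Theorem theorem3p2 (L : loopType) (A : aut_group L) :
  osborn (holomorph A) <->
  [/\ osborn L,
      (forall (x : L) (alpha phi : automorphism L), A alpha -> A phi ->
         in_nucleus (alpha x * rho x) /\ in_nucleus (lam x * phi x)),
      (forall (x : L) (alpha : automorphism L), A alpha ->
         (alpha x * rho x) * x = alpha x) &
      (forall (x : L) (phi : automorphism L), A phi ->
         x * (lam x * phi^-1 x) = phi^-1 x)].
Proof.
split=> [/osborn_id2P/holomorph_osborn_id2P H|].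
  have O2 : osborn_id2 L.
    by move=> x y z; apply: (H 1 1); apply: in_aut1.
  have O1 := osborn_id2_id1 L O2.
  have Q x (phi : automorphism L) : A phi ->
      in_lnucleus (phi x * rho x) /\ (phi x * rho x) * x = phi x.
    move=> Aphi; apply: lnucleus_quotient => // y z.
    exact: (H phi 1 x y z Aphi (in_aut1 A)).
  split; first exact/osborn_id2P.
  - move=> x alpha phi Aalpha Aphi; split.
      by apply: lnucleus_nucleus => //; have [] := Q x _ Aalpha.
    have [Nn <-] := Q x _ Aphi; apply: lnucleus_nucleus => //.
    exact: lam_mul_lnucleus.
  - by move=> x alpha Aalpha; have [] := Q x _ Aalpha.
  - move=> x phi Aphi; have [Nn <-] := Q x _ (in_autV Aphi).
    exact: mul_lam_lnucleus.
case=> /osborn_id2P O2 N E _.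
apply/osborn_id2P/holomorph_osborn_id2P=> phi delta x y z Aphi Adelta.
have [Nd _] := N x _ _ Adelta Adelta.
have [[_ Nn _] _] := N x _ _ Aphi Aphi.
(* First [delta x] is replaced by [x], then [phi x = n * x] lets [n] factor out on the left. *)
rewrite -(E x _ Adelta) mul_lam_nucleus // -(E x _ Aphi).
by rewrite -!Nn O2.
Qed.
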